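(* The posets $\overline{\mathcal{FP}}$ and $\overline{\mathcal{SC}}$ are isomorphic.
   Context: $G=(V,E)$ is a finite connected graph, possibly with parallel edges and loops; $\mathbb E$ is the set of oriented edges ($e$ and its reverse $\bar e$). Real $1$-chains $x:\mathbb E\to\mathbb R$ satisfy $x_{\bar e}=-x_e$; $\langle x,y\rangle=\sum_{e\in E}x_ey_e$, $q(x)=\langle x,x\rangle$. A flow satisfies $\sum_{e\text{ with tail }v}x_e=0$ at every vertex $v$; $H$ is the space of real flows and $\Lambda$ the lattice of integer flows. $V_\lambda=\{x\in H: q(x-\lambda)\le q(x-\mu)\ \forall\mu\in\Lambda\}$. $\overline{\mathcal{FP}}$ is the set of nonempty faces of all Voronoi cells $V_\lambda$, $\lambda\in\Lambda$, modulo translation by $\Lambda$ (equivalently, faces $F_1,F_2$ of $V_O$ are identified iff $F_2=F_1+\lambda$ for some $\lambda\in\Lambda$), ordered by $[F_1]\le[F_2]$ iff some representatives satisfy $F_1\subseteq F_2$. $\mathcal{SC}$ is the set of pairs $(H',D)$ with $H'$ a subgraph of $G$ (identified with its edge set) and $D$ a strongly connected orientation of $H'$ (on each component any two vertices joined by directed paths both ways), with $(H_1,D_1)\preceq(H_2,D_2)$ iff $H_2\subseteq H_1$ and $D_2$ is the restriction of $D_1$. On $\mathcal{SC}$, $(H_1,D_1)\sim(H_2,D_2)$ iff $H_1=H_2$ and $D_1,D_2$ have the same out-degree function ($v\mapsto$ number of arcs with tail $v$). $\overline{\mathcal{SC}}=\mathcal{SC}/\sim$ with $[D_1]\preceq[D_2]$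 iff some representatives satisfy $D_1\preceq D_2$. *)

(* Defs.v *)
From HB Require Import structures.
From mathcomp Require Import all_boot all_order all_algebra.
Set Implicit Arguments. Unset Strict Implicit. Unset Printing Implicit Defensive.
Import Order.TTheory GRing.Theory Num.Theory.
Local Open Scope ring_scope.

(* A finite multigraph (parallel edges and loops allowed) on vertex type V
   with edge type E; every edge e carries a reference orientation
   src e -> tgt e.  The oriented edge set is E * bool (e and its reverse);
   a real 1-chain x (with x_(reverse e) = - x_e) is determined by its values
   on the reference orientations, so it is a function E -> R. *)

Section Graph.
Variables (V E : finType) (src tgt : E -> V).

Definition gadj : rel V :=
  fun u v => [exists e, ((src e == u) && (tgt e == v)) || ((src e == v) && (tgt e == u))].

Definition connected_graph : Prop := forall u v : V, connect gadj u v.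

Section Chains.
Variable R : realFieldType.

Definition dotc (x y : E -> R) : R := \sum_(e : E) x e * y e.
Definition qc (x : E -> R) : R := dotc x x.

(* flow condition: sum over oriented edges with tail v of x = 0
   (a loop e at v contributes x_e + x_(reverse e) = 0) *)
Definition is_flow (x : E -> R) : Prop :=
  forall v : V, \sum_(e : E | src e == v) x e - \sum_(e : E | tgt e == v) x e = 0.

Definition in_Lambda (l : E -> R) : Prop :=
  (exists z : E -> int, forall e, l e = (z e)%:~R) /\ is_flow l.

Definition voronoiO (x : E -> R) : Prop :=
  is_flow x /\ forall mu, in_Lambda mu -> qc x <= qc (fun e => x e - mu e).

(* nonempty faces of a convex set C (intersection with a supporting
   hyperplane; a = 0, b = 0 gives C itself) *)
Definition is_face (C F : (E -> R) -> Prop) : Prop :=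
  (exists x, F x) /\
  exists (a : E -> R) (b : R),
    (forall x, C x -> dotc a x <= b) /\ (forall x, F x <-> (C x /\ dotc a x = b)).

Definition FP := {F : (E -> R) -> Prop | is_face voronoiO F}.

Definition fp_eq (F1 F2 : FP) : Prop :=
  exists l, in_Lambda l /\ forall x, sval F2 x <-> sval F1 (fun e => x e - l e).

(* [F1] <= [F2] iff some representatives (faces of Voronoi cells) satisfy
   F1 + lambda subset F2 + mu, i.e. F1 + (lambda - mu) subset F2 *)
Definition fp_le (F1 F2 : FP) : Prop :=
  exists l, in_Lambda l /\ forall x, sval F1 x -> sval F2 (fun e => x e + l e).

End Chains.

(* A pair (H', D): a partial orientation D : E -> option bool, where
   D e = None means e is not in H', D e = Some true means e is oriented
   src e -> tgt e, and D e = Some false means tgt e -> src e. *)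
Definition porient := {ffun E -> option bool}.

Definition darc (D : porient) : rel V :=
  fun u v => [exists e, ((D e == Some true) && (src e == u) && (tgt e == v))
                     || ((D e == Some false) && (tgt e == u) && (src e == v))].

Definition uarc (D : porient) : rel V :=
  fun u v => [exists e, (D e != None) &&
      (((src e == u) && (tgt e == v)) || ((src e == v) && (tgt e == u)))].

Definition strongly_connected (D : porient) : Prop :=
  forall u v : V, connect (uarc D) u v -> connect (darc D) u v.

Definition SC := {D : porient | strongly_connected D}.

Definition outdeg (D : porient) (v : V) : nat :=
  #|[set e : E | ((D e == Some true) && (src e == v))
              || ((D e == Some false) && (tgt e == v))]|.

Definition sc_eq (D1 D2 : SC) : Prop :=
  (forall e, (sval D1 e == None) = (sval D2 e == None)) /\
  (forall v, outdeg (sval D1) v = outdeg (sval D2) v).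

Definition sc_pre (D1 D2 : SC) : Prop :=
  forall e, sval D2 e != None -> sval D1 e = sval D2 e.

Definition sc_le (D1 D2 : SC) : Prop :=
  exists D1' D2' : SC, sc_eq D1 D1' /\ sc_eq D2 D2' /\ sc_pre D1' D2'.

End Graph.

(* Isomorphism of the quotient posets A/eqA (ordered by leA) and B/eqB
   (ordered by leB), expressed on representatives: maps f, g respecting
   the equivalences, mutually inverse up to equivalence, and f preserving
   and reflecting the order. *)
Definition quotient_poset_iso (A B : Type)
  (eqA leA : A -> A -> Prop) (eqB leB : B -> B -> Prop) : Prop :=
  exists (f : A -> B) (g : B -> A),
    (forall a1 a2, eqA a1 a2 -> eqB (f a1) (f a2)) /\
    (forall b1 b2, eqB b1 b2 -> eqA (g b1) (g b2)) /\
    (forall a, eqA (g (f a)) a) /\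
    (forall b, eqB (f (g b)) b) /\
    (forall a1 a2, leA a1 a2 <-> leB (f a1) (f a2)).

(* Main.v *)
Require Import Defs.
From HB Require Import structures.
From mathcomp Require Import all_boot all_order all_algebra.
From mathcomp Require Import ring lra.
From Stdlib Require Import FunctionalExtensionality IndefiniteDescription.

Set Implicit Arguments. Unset Strict Implicit. Unset Printing Implicit Defensive.
Import Order.TTheory GRing.Theory Num.Theory.
Local Open Scope ring_scope.

(** The Voronoi cell of the origin is a zonotope: it is the orthogonal projection
    of the cube [-1/2, 1/2]^E to the flow space H.  One inclusion is the bound
    [2 <eps, mu> <= sum |mu_e| <= q mu] for integer flows [mu]; for the other, a
    potential that moves a point of the cell into the cube along the orthogonal
    complement of H exists by a shortest-path argument, since the Voronoi
    inequalities of simple cycles say that there is no negative cycle.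
    Hence the faces of the cell correspond to the sign vectors of real flows,
    and these are exactly the strongly connected partial orientations.
    If the face of [D1] translated by an integer flow [l] lies in the face of
    [D2], comparing norms at the projection of [D1 / 2] forces [l = - D1] on the
    support of [l], so that [D1 + 2 l] is again an orientation; it has the same
    out-degrees as [D1], because [l] is a flow, and it extends [D2]. *)

(** * Shortest walks and feasible potentials in a weighted digraph *)

Section FeasiblePotential.
Variables (R : realFieldType) (V A : finType) (tail head : A -> V) (w : A -> R).

(* Arcs are listed from the last one, which enters [v], back to the first. *)
Fixpoint back_walk (v : V) (p : seq A) : bool :=
  if p is a :: q then (head a == v) && back_walk (tail a) q else true.

Definition walk_weight (p : seq A) : R := \sum_(a <- p) w a.

Definition simple_back_walk v p :=
  back_walk v p && uniq (v :: [seq tail a | a <- p]).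

Lemma back_walk_cat v p q :
  back_walk v (p ++ q) = back_walk v p && back_walk (last v [seq tail a | a <- p]) q.
Proof. by elim: p v => [|a p IH] v //=; rewrite IH andbA. Qed.

Lemma back_walk_split v u p : v \in u :: [seq tail a | a <- p] ->
  exists p1 p2, p = p1 ++ p2 /\ last u [seq tail a | a <- p1] = v.
Proof.
elim: p u => [|a p IH] u /=; first by rewrite inE => /eqP ->; exists [::], [::].
rewrite inE => /orP[/eqP ->|/IH [p1 [p2 [-> <-]]]]; first by exists [::], (a :: p).
by exists (a :: p1), p2.
Qed.

Hypothesis no_negative_cycle : forall v a p,
  back_walk v (a :: p) -> last v [seq tail b | b <- a :: p] = v ->
  uniq [seq tail b | b <- a :: p] -> 0 <= walk_weight (a :: p).

(* [f v] is the least weight of a simple walk ending at [v]. *)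
Lemma feasible_potential : exists f : V -> R, forall a, f (head a) <= f (tail a) + w a.
Proof.
(* A simple walk has at most [#|V|] arcs, so the minimum ranges over a finite type; the default
   [[bseq]] is the empty walk, which is simple. *)
pose T := #|V|.-bseq A.
pose best v : T := [arg min_(p < [bseq] | simple_back_walk v (p : T)) walk_weight p]%O.
have bestP v : simple_back_walk v (best v) /\
    (forall p, simple_back_walk v p -> walk_weight (best v) <= walk_weight p).
  rewrite /best; case: arg_minP => //= q qP qmin; split=> // p pP.
  have sp : (size p <= #|V|)%N.
    case/andP: pP => _ /= /andP[_ /card_uniqP].
    by rewrite size_map => <-; apply: max_card.
  exact: (qmin (Bseq sp)).
exists (fun v => walk_weight (best v)) => a.
have [/andP[bw un] _] := bestP (tail a).
have [_ min_v] := bestP (head a).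
have [vin|vnin] := boolP (head a \in tail a :: [seq tail b | b <- best (tail a)]).
  (* The best walk already meets [head a]. Its final part [p1] closes up with [a] to a cycle of
     nonnegative weight, while [p2] is a simple walk ending at [head a]. *)
  have [p1 [p2 [ep lst]]] := back_walk_split vin.
  move: bw un; rewrite ep back_walk_cat lst map_cat -cat_cons cat_uniq.
  move=> /andP[bw1 bw2] /and3P[un1 dis un2].
  have p2P : simple_back_walk (head a) p2.
    rewrite /simple_back_walk bw2 /= un2 andbT.
    apply: contra dis => hin; apply/hasP; exists (head a) => //.
    by rewrite -lst mem_last.
  have := @no_negative_cycle (head a) a p1.
  rewrite /= eqxx bw1 lst => /(_ isT erefl un1).
  move: (min_v _ p2P); rewrite /walk_weight big_cons big_cat /=; lra.
have := min_v (a :: best (tail a)); rewrite /simple_back_walk /= eqxx bw.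
move: un => /= ->; rewrite vnin /= => /(_ isT).
by rewrite /walk_weight big_cons addrC.
Qed.

End FeasiblePotential.

(** * Orthogonal complements over an ordered field *)

Section OrthogonalDecomposition.
Variable R : realFieldType.

(** A vector in both the row space of [B] and the kernel of [B^T] is orthogonal to itself, hence
    zero; by a rank count the two subspaces then span everything. *)
Lemma row_space_kermx_decomposition m n (B : 'M[R]_(m, n)) (u : 'rV[R]_n) :
  exists f : 'rV[R]_m, (u - f *m B) *m B^T = 0.
Proof.
have cap0 : (B :&: kermx B^T)%MS = 0.
  apply/eqP; rewrite -submx0; apply/rV_subP => x; rewrite sub_capmx => /andP[].
  case/submxP => f xE /sub_kermxP xk.
  have xx : x *m x^T = 0 by rewrite {2}xE trmx_mul mulmxA xk mul0mx.
  suff -> : x = 0 by rewrite sub0mx.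
  apply/rowP => j; rewrite mxE.
  have /matrixP/(_ 0 0) := xx; rewrite !mxE => /eqP.
  rewrite psumr_eq0 => [/allP/(_ j (mem_index_enum _))|k _]; rewrite !mxE -expr2.
    by rewrite sqrf_eq0 => /eqP.
  exact: sqr_ge0.
have full : (1%:M <= B + kermx B^T)%MS.
  rewrite sub1mx -col_leq_rank.
  have := mxrank_sum_cap B (kermx B^T); rewrite cap0 mxrank0 addn0 => ->.
  by rewrite mxrank_ker mxrank_tr subnKC // rank_leq_col.
have /sub_addsmxP[[f k] /= uE] : (u <= B + kermx B^T)%MS.
  exact: submx_trans (submx1 _) full.
by exists f; rewrite uE addrAC subrr add0r -mulmxA mulmx_ker mulmx0.
Qed.

End OrthogonalDecomposition.

(** * Boundary, coboundary and the flow space *)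

Section Flows.
Variables (R : realFieldType) (V E : finType) (src tgt : E -> V).
Implicit Types (x y eps l : E -> R) (f : V -> R) (D : porient E).

Definition boundary x v : R := \sum_(e | src e == v) x e - \sum_(e | tgt e == v) x e.

Definition coboundary f e : R := f (tgt e) - f (src e).

Lemma boundaryE x v :
  boundary x v = \sum_e ((src e == v)%:R - (tgt e == v)%:R) * x e.
Proof.
rewrite /boundary !(big_mkcond (fun e => _ == v)) -sumrB.
by apply: eq_bigr => e _; case: eqP; case: eqP => _ _; rewrite /=; ring.
Qed.

Lemma boundary_linear c x y v :
  boundary (fun e => x e + c * y e) v = boundary x v + c * boundary y v.
Proof. by rewrite !boundaryE mulr_sumr -big_split; apply: eq_bigr => e _ /=; ring. Qed.

Lemma is_flow_linear c x y : is_flow src tgt x -> is_flow src tgt y ->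
  is_flow src tgt (fun e => x e + c * y e).
Proof.
by move=> hx hy v; rewrite -/(boundary _ v) boundary_linear /boundary hx hy mulr0 addr0.
Qed.

Lemma is_flowD x y : is_flow src tgt x -> is_flow src tgt y ->
  is_flow src tgt (fun e => x e + y e).
Proof.
move=> hx hy; have := is_flow_linear 1 hx hy; congr is_flow.
by apply: functional_extensionality => e; rewrite mul1r.
Qed.

Lemma is_flowB x y : is_flow src tgt x -> is_flow src tgt y ->
  is_flow src tgt (fun e => x e - y e).
Proof.
move=> hx hy; have := is_flow_linear (-1) hx hy; congr is_flow.
by apply: functional_extensionality => e; rewrite mulN1r.
Qed.

Lemma is_flowN x : is_flow src tgt x -> is_flow src tgt (fun e => - x e).
Proof.
move=> hx v; have := hx v; rewrite !sumrN -opprD => /eqP.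
by rewrite subr_eq0 => /eqP ->; rewrite subrr oppr0.
Qed.

Lemma is_flow0 : is_flow src tgt (fun _ => 0 : R).
Proof. by move=> v; rewrite !big1 ?subrr. Qed.

Lemma in_Lambda0 : in_Lambda src tgt (fun _ => 0 : R).
Proof. by split; [exists (fun=> 0)|exact: is_flow0]. Qed.

Lemma in_LambdaN l : in_Lambda src tgt l -> in_Lambda src tgt (fun e => - l e).
Proof.
move=> [[z lz] hl]; split; last exact: is_flowN.
by exists (fun e => - z e) => e; rewrite lz rmorphN.
Qed.

Lemma dotcC x y : dotc x y = dotc y x.
Proof. by apply: eq_bigr => e _; rewrite mulrC. Qed.

Lemma dotcD x y z : dotc x (fun e => y e + z e) = dotc x y + dotc x z.
Proof. by rewrite /dotc -big_split; apply: eq_bigr => e _ /=; rewrite mulrDr. Qed.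

Lemma qcD x y : qc (fun e => x e + y e) = qc x + 2 * dotc x y + qc y.
Proof.
by rewrite /qc /dotc mulr_sumr -!big_split; apply: eq_bigr => e _ /=; ring.
Qed.

Lemma qcB x y : qc (fun e => x e - y e) = qc x - 2 * dotc x y + qc y.
Proof.
rewrite /qc /dotc mulr_sumr -sumrB -!big_split; apply: eq_bigr => e _ /=; ring.
Qed.

(** Summation by parts: up to sign, the two operators are adjoint. Hence coboundaries are orthogonal
    to flows. *)
Lemma sum_boundary f x : \sum_v f v * boundary x v = - dotc (coboundary f) x.
Proof.
under eq_bigr => v _ do rewrite boundaryE mulr_sumr.
rewrite exchange_big /dotc -sumrN; apply: eq_bigr => e _ /=.
under eq_bigr => v _ do rewrite mulrA mulrBr.
rewrite -mulr_suml sumrB /coboundary.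
have pick u : \sum_v f v * (u == v)%:R = f u.
  rewrite (bigD1 u) //= eqxx mulr1 big1 ?addr0 // => v; rewrite eq_sym.
  by move=> /negbTE ->; rewrite mulr0.
by rewrite !pick; ring.
Qed.

Lemma dotc_coboundary f x : is_flow src tgt x -> dotc x (coboundary f) = 0.
Proof.
move=> hx; apply/eqP; rewrite dotcC -oppr_eq0 -sum_boundary big1 // => v _.
by rewrite /boundary hx mulr0.
Qed.

Lemma flow_decomposition eps :
  exists x f, is_flow src tgt x /\ forall e, eps e = x e + coboundary f e.
Proof.
(* The incidence matrix, signed so that [g *m B] is the coboundary of [g]; a residual killed by
   [B^T] is then a flow. *)
pose B : 'M[R]_(#|V|, #|E|) := \matrix_(i, j)
  ((tgt (enum_val j) == enum_val i)%:R - (src (enum_val j) == enum_val i)%:R).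
have [g gP] := row_space_kermx_decomposition B (\row_j eps (enum_val j)).
pose f v := g 0 (enum_rank v).
have gB e : (g *m B) 0 (enum_rank e) = coboundary f e.
  rewrite mxE (reindex enum_rank) /=; last first.
    by exists enum_val => v _; [exact: enum_rankK|exact: enum_valK].
  under eq_bigr => v _ do rewrite !mxE !enum_rankK mulrBr.
  have pick u : \sum_v g 0 (enum_rank v) * (u == v)%:R = f u.
    rewrite (bigD1 u) //= eqxx mulr1 big1 ?addr0 // => v; rewrite eq_sym.
    by move=> /negbTE ->; rewrite mulr0.
  by rewrite sumrB !pick.
exists (fun e => eps e - coboundary f e), f; split; last by move=> e; rewrite subrK.
move=> v; rewrite -/(boundary _ v) boundaryE.
have := congr1 (fun M : 'rV_ _ => - M 0 (enum_rank v)) gP.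
rewrite mxE [in X in _ = X]mxE oppr0 -sumrN (reindex enum_rank) /=; last first.
  by exists enum_val => e _; [exact: enum_rankK|exact: enum_valK].
move=> h; apply: etrans h; apply: eq_bigr => e _.
by rewrite -gB !mxE !enum_rankK; ring.
Qed.

(** * Strongly connected orientations as sign vectors of flows *)

Definition sg (d : option bool) : R :=
  match d with Some true => 1 | Some false => -1 | None => 0 end.

Definition osg (r : R) : option bool := if r == 0 then None else Some (0 < r).

Lemma sg_inj : injective sg.
Proof. by move=> [[]|] [[]|] //= h; exfalso; lra. Qed.

Lemma sg_osg r : sg (osg r) * r = `|r|.
Proof.
rewrite /osg; case: eqP => [->|/eqP r0] /=; first by rewrite normr0 mulr0.
by case: ltP => h; [rewrite gtr0_norm|rewrite ler0_norm] => //; ring.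
Qed.

Lemma osgK d r : 0 < r -> osg (sg d * r) = d.
Proof.
move=> r0; rewrite /osg; case: d => [[]|] /=; rewrite ?mul1r ?mulN1r ?mul0r ?eqxx //.
  by rewrite gt_eqF // r0.
by rewrite oppr_eq0 gt_eqF // oppr_gt0 ltNge ltW.
Qed.

Lemma osg_None r : (osg r == None) = (r == 0).
Proof. by rewrite /osg; case: (r == 0). Qed.

(** Let [t] count how often a directed path uses each edge; the boundary telescopes along the
    path. *)
Lemma path_chain D u v : connect (darc src tgt D) u v ->
  exists t : E -> R, (forall e, 0 <= t e) /\
    forall z, boundary (fun e => sg (D e) * t e) z = (u == z)%:R - (v == z)%:R.
Proof.
case/connectP => p; elim: p u => [|a p IH] u /=.
  move=> _ ->; exists (fun=> 0); split=> // z.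
  by rewrite subrr boundaryE big1 // => e _; rewrite !mulr0.
case/andP => /existsP[e ue] /IH{}IH /IH [t [t0 tb]].
exists (fun e' => t e' + (e' == e)%:R); split=> [e'|z].
  by rewrite addr_ge0 ?ler0n.
have -> : (fun e' => sg (D e') * (t e' + (e' == e)%:R)) =
    (fun e' => sg (D e') * t e' + 1 * (sg (D e') * (e' == e)%:R)).
  by apply: functional_extensionality => e'; ring.
rewrite boundary_linear tb boundaryE (bigD1 e) //= eqxx.
rewrite big1 ?addr0 => [|e' /negbTE ->]; last by rewrite !mulr0.
by case/orP: ue => /andP[/andP[/eqP -> /eqP ->] /eqP ->] /=; ring.
Qed.

Definition flow_orientation D :=
  exists y, is_flow src tgt y /\ forall e, osg (y e) = D e.

(** Each arc of [D], closed up by a directed path back to its tail, carries a nonnegative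
    circulation along [D] that is positive on that arc. The sum of these circulations has sign
    vector [D]. *)
Lemma strongly_connected_flow D : strongly_connected src tgt D -> flow_orientation D.
Proof.
move=> sc.
have circ e : exists t : E -> R, (forall e', 0 <= t e') /\
    is_flow src tgt (fun e' => sg (D e') * t e') /\ (D e != None -> 0 < t e).
  have [De|De] := eqVneq (D e) None.
    exists (fun=> 0); split=> //; split=> // v.
    by rewrite !big1 ?subrr // => *; rewrite mulr0.
  have back u v : uarc src tgt D v u -> connect (darc src tgt D) v u.
    by move=> ?; apply: sc; apply: connect1.
  have eu : uarc src tgt D (src e) (tgt e).
    by apply/existsP; exists e; rewrite De !eqxx.
  have eu' : uarc src tgt D (tgt e) (src e).
    by apply/existsP; exists e; rewrite De !eqxx orbT.
  have cl : exists t : E -> R, (forall e', 0 <= t e') /\ forall z,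
      boundary (fun e => sg (D e) * t e) z =
      - (sg (D e) * ((src e == z)%:R - (tgt e == z)%:R)).
    move: De; case Dee: (D e) => [[]|] // _.
      have [t [t0 tb]] := path_chain (back _ _ eu').
      by exists t; split=> // z; rewrite tb /=; ring.
    have [t [t0 tb]] := path_chain (back _ _ eu).
    by exists t; split=> // z; rewrite tb /=; ring.
  case: cl => t [t0 tb]; exists (fun e' => t e' + (e' == e)%:R).
  split=> [e'|]; first by rewrite addr_ge0 ?ler0n.
  split=> [z|_]; last by by rewrite eqxx ltr_wpDl.
  rewrite -/(boundary (fun e' => sg (D e') * (t e' + (e' == e)%:R)) z).
  have -> : (fun e' => sg (D e') * (t e' + (e' == e)%:R)) =
      (fun e' => sg (D e') * t e' + 1 * (sg (D e') * (e' == e)%:R)).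
    by apply: functional_extensionality => e'; ring.
  rewrite boundary_linear tb boundaryE (bigD1 e) //= eqxx.
  rewrite big1 ?addr0 => [|e' /negbTE ->]; last by rewrite !mulr0.
  by rewrite /= mulr1n; ring.
have [t tP] := fin_all_exists circ.
exists (fun e => sg (D e) * \sum_e' t e' e); split=> [v|e].
  rewrite -/(boundary _ v) boundaryE.
  under eq_bigr => e _ do rewrite !mulr_sumr.
  rewrite exchange_big big1 //= => e' _.
  by rewrite -boundaryE; have [_ [tf _]] := tP e'; exact: tf.
have [->|De] := eqVneq (D e) None; first by rewrite mul0r /osg eqxx.
apply: osgK; rewrite (bigD1 e) //= ltr_pwDl //.
  by have [_ [_ ->]] := tP e.
by apply: sumr_ge0 => e' _; have [-> _] := tP e'.
Qed.

Lemma flow_strongly_connected D : flow_orientation D -> strongly_connected src tgt D.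
Proof.
move=> [y [yf yD]] u v; apply: connect_sub => {u v} u v /existsP[e /andP[De euv]].
apply/idPn => nuv.
(* No arc leaves the set reachable from [u], so by conservation none enters it. *)
pose U w : R := (connect (darc src tgt D) u w)%:R.
have term e' : 0 <= coboundary U e' * y e'.
  rewrite /coboundary /U; move: (yD e'); rewrite /osg.
  case: eqP => [->|_ De']; first by rewrite mulr0.
  have arc a b : darc src tgt D a b ->
      connect (darc src tgt D) u a -> connect (darc src tgt D) u b.
    by move=> ab ua; apply: connect_trans ua _; apply: connect1.
  case: ltP De' => y0 De'.
    have := arc (src e') (tgt e'); rewrite /darc.
    case: existsP => [_ /(_ isT)|[]]; last by exists e'; rewrite -De' !eqxx.
    by case: connect => [->//|_]; rewrite ?subrr ?mul0r // subr0 mulr_ge0 ?ler0n // ltW.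
  have := arc (tgt e') (src e'); rewrite /darc.
  case: existsP => [_ /(_ isT)|[]]; last by exists e'; rewrite -De' !eqxx orbT.
  case: (connect _ u (tgt e')) => [->//|_]; rewrite ?subrr ?mul0r // sub0r.
  by rewrite mulNr -mulrN mulr_ge0 ?ler0n // oppr_ge0.
(* The nonnegative terms sum to zero, so each vanishes. As [y e] is nonzero, [U] agrees at both ends
   of [e], against [nuv]. *)
have := dotc_coboundary U yf; rewrite dotcC => /eqP.
rewrite /dotc psumr_eq0 => [/allP/(_ e (mem_index_enum _))|? _]; last exact: term.
have ye : y e != 0 by rewrite -osg_None yD.
rewrite /= mulf_eq0 (negbTE ye) orbF /coboundary /U.
case/orP: euv => /andP[/eqP -> /eqP ->]; rewrite connect0 (negbTE nuv) /= => /eqP h; lra.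
Qed.

(** * The Voronoi cell as a projected cube *)

Definition half_box eps := forall e, `|eps e| <= 2^-1.

(* The orthogonal projection to the flow space of the face of the cube
   [-1/2, 1/2]^E on which [eps] agrees with [D / 2]. *)
Definition zonotope_face D x :=
  is_flow src tgt x /\ exists eps f, half_box eps /\
    (forall e, D e != None -> eps e = sg (D e) / 2) /\
    (forall e, eps e = x e + coboundary f e).

Lemma half_box_sg D : half_box (fun e => sg (D e) / 2).
Proof.
move=> e; rewrite ler_norml; case: (D e) => [[]|] /=; lra.
Qed.

Lemma dotc_lift y x eps f : is_flow src tgt y ->
  (forall e, eps e = x e + coboundary f e) -> dotc y eps = dotc y x.
Proof.
move=> yf h; rewrite (functional_extensionality _ _ h).
by rewrite dotcD dotc_coboundary // addr0.
Qed.

Lemma voronoiOE x : voronoiO src tgt x <->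
  is_flow src tgt x /\ forall mu, in_Lambda src tgt mu -> 2 * dotc x mu <= qc mu.
Proof.
by split=> -[xf h]; split=> // mu /h; rewrite qcB; lra.
Qed.

(** A nonzero integer has absolute value at least 1. This turns the bound given by the cube into the
    Voronoi inequality. *)
Lemma norm_le_sqr_int (z : int) : `|z%:~R| <= z%:~R ^+ 2 :> R.
Proof.
rewrite -intr_norm -rmorphXn ler_int -real_normK ?num_real //.
have [->//|z0] := eqVneq z 0.
by rewrite expr2 ler_peMl // -gtz0_ge1 normr_gt0.
Qed.

Lemma zonotope_face_voronoiO D x : zonotope_face D x -> voronoiO src tgt x.
Proof.
move=> [xf [eps [f [box [_ epsE]]]]]; apply/voronoiOE; split=> // mu [[z muz] muf].
rewrite dotcC -(dotc_lift muf epsE) /qc /dotc mulr_sumr; apply: ler_sum => e _.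
have := norm_le_sqr_int (z e); rewrite -muz -expr2; apply: le_trans.
apply: le_trans (ler_norm _) _; rewrite !normrM ger0_norm //.
by have := box e; have := normr_ge0 (mu e); nra.
Qed.

Definition arc_tail (a : E * bool) := if a.2 then src a.1 else tgt a.1.
Definition arc_head (a : E * bool) := if a.2 then tgt a.1 else src a.1.

Lemma sum_arcs (c : seq (E * bool)) (F : E * bool -> R) : uniq c ->
  \sum_(a <- c) F a =
  \sum_e (((e, true) \in c)%:R * F (e, true) + ((e, false) \in c)%:R * F (e, false)).
Proof.
move=> uc; rewrite big_uniq //= big_mkcond /=.
rewrite (eq_bigr (fun a => ((a.1, a.2) \in c)%:R * F (a.1, a.2))); last first.
  by move=> [e b] _ /=; case: ifP; rewrite ?mul1r ?mul0r.
rewrite -(pair_bigA _ (fun e b => ((e, b) \in c)%:R * F (e, b))) /=.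
by apply: eq_bigr => e _; rewrite big_bool.
Qed.

Lemma back_walk_telescope v c z : back_walk arc_tail arc_head v c ->
  \sum_(a <- c) ((arc_tail a == z)%:R - (arc_head a == z)%:R) =
  (last v [seq arc_tail a | a <- c] == z)%:R - (v == z)%:R :> R.
Proof.
elim: c v => [|a c IH] v /=; first by rewrite big_nil subrr.
by move=> /andP[/eqP <- /IH]; rewrite big_cons => ->; ring.
Qed.

Lemma simple_cycle_weight x v c : voronoiO src tgt x ->
  back_walk arc_tail arc_head v c -> last v [seq arc_tail a | a <- c] = v ->
  uniq [seq arc_tail a | a <- c] ->
  0 <= \sum_(a <- c) (2^-1 - sg (Some a.2) * x a.1).
Proof.
move=> /voronoiOE[_ xV] cw cl /map_uniq uc.
pose mu e : R := ((e, true) \in c)%:R - ((e, false) \in c)%:R.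
have muL : in_Lambda src tgt mu.
  split.
    exists (fun e => ((e, true) \in c)%:Z - ((e, false) \in c)%:Z) => e.
    by rewrite rmorphB.
  move=> z; rewrite -/(boundary _ z) boundaryE.
  have := back_walk_telescope z cw; rewrite cl subrr sum_arcs // => h.
  by apply: etrans h; apply: eq_bigr => e _; rewrite /mu /arc_tail /arc_head /=; ring.
have := xV _ muL; rewrite sum_arcs // /qc /dotc mulr_sumr -subr_ge0 -sumrB => h.
rewrite -(pmulr_rge0 _ (ltr0n R 2)) mulr_sumr; apply: le_trans h _.
apply: ler_sum => e _; rewrite /mu /=.
(* An edge traversed both ways has [mu e = 0], while its two arc weights add up to 1, so the
   inequality survives. *)
by case: (_ \in c); case: (_ \in c) => /=; lra.
Qed.

(** The empty orientation fixes no coordinate, so its face is the projection of the whole cube.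
    Feasibility of the potential on the two arcs of an edge is exactly the pair of cube bounds at
    that edge. *)
Lemma voronoiO_zonotope_face x : voronoiO src tgt x ->
  zonotope_face [ffun=> None] x.
Proof.
move=> xV; split; first by case: xV.
have [|f fP] := @feasible_potential R V _ arc_tail arc_head
  (fun a => 2^-1 - sg (Some a.2) * x a.1).
  by move=> v a p bw lst un; apply: simple_cycle_weight bw lst un.
exists (fun e => x e + coboundary f e), f.
split=> [e|]; last by split=> // e; rewrite ffunE.
rewrite ler_norml /coboundary.
have := fP (e, true); have := fP (e, false); rewrite /arc_tail /arc_head /=.
by move=> *; apply/andP; split; lra.
Qed.

(** * Faces of the cell as sets of maximisers *)

(** The support function of the cube; on flows it is also that of the Voronoi cell. *)
Definition half_norm1 y : R := \sum_e `|y e| / 2.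

Lemma half_norm1_max y eps : half_box eps -> dotc y eps <= half_norm1 y.
Proof.
move=> box; apply: ler_sum => e _; apply: le_trans (ler_norm _) _.
by rewrite normrM ler_wpM2l.
Qed.

Lemma half_norm1_attained y eps : half_box eps -> (dotc y eps = half_norm1 y <->
  forall e, osg (y e) != None -> eps e = sg (osg (y e)) / 2).
Proof.
move=> box; split=> [/esym/eqP|h]; last first.
  apply: eq_bigr => e _; have [|/h ->] := eqVneq (osg (y e)) None.
    by move/eqP; rewrite osg_None => /eqP ->; rewrite normr0 !mul0r.
  by rewrite mulrA (mulrC (y e)) sg_osg.
rewrite -subr_eq0 /dotc /half_norm1 -sumrB psumr_eq0 => [/allP h e ye|e _]; last first.
  rewrite subr_ge0; apply: le_trans (ler_norm _) _.
  by rewrite normrM ler_wpM2l.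
have /eqP := h e (mem_index_enum _); rewrite -sg_osg => hh.
have : y e * (sg (osg (y e)) / 2 - eps e) = 0 by rewrite -hh; ring.
move/eqP; rewrite mulf_eq0 -osg_None (negbTE ye) /= subr_eq0.
by move=> /eqP ->.
Qed.

Lemma voronoiO_half_norm1 y x : is_flow src tgt y -> voronoiO src tgt x ->
  dotc y x <= half_norm1 y.
Proof.
move=> yf /voronoiO_zonotope_face[_ [eps [f [box [_ epsE]]]]].
by rewrite -(dotc_lift yf epsE) half_norm1_max.
Qed.

(** Pairing with a flow is unchanged by projection, so maximising over the cell amounts to
    maximising over the cube, where the maximisers are the points equal to [D / 2] on the support of
    [y]. *)
Lemma zonotope_faceP D y x : is_flow src tgt y -> (forall e, osg (y e) = D e) ->
  zonotope_face D x <-> voronoiO src tgt x /\ dotc y x = half_norm1 y.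
Proof.
move=> yf yD; split=> [xD|[xV]].
  split; first exact: zonotope_face_voronoiO xD.
  case: xD => _ [eps [f [box [epsD epsE]]]].
  rewrite -(dotc_lift yf epsE); apply/half_norm1_attained => // e.
  by rewrite yD; exact: epsD.
have [xf [eps [f [box [_ epsE]]]]] := voronoiO_zonotope_face xV.
rewrite -(dotc_lift yf epsE) half_norm1_attained // => h.
split=> //; exists eps, f; split=> //; split=> // e.
by rewrite -yD; exact: h.
Qed.

(** The projection of [D / 2] is the centre of the face and serves as its test point. *)
Lemma zonotope_face_center D : exists x f, zonotope_face D x /\
  forall e, sg (D e) / 2 = x e + coboundary f e.
Proof.
have [x [f [xf h]]] := flow_decomposition (fun e => sg (D e) / 2).
exists x, f; split=> //; split=> //; exists (fun e => sg (D e) / 2), f.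
by split; first exact: half_box_sg.
Qed.

Lemma zonotope_face_is_face D : flow_orientation D ->
  is_face (@voronoiO V E src tgt R) (zonotope_face D).
Proof.
move=> [y [yf yD]]; split.
  by have [x [f [xD _]]] := zonotope_face_center D; exists x.
exists y, (half_norm1 y); split=> x; first exact: voronoiO_half_norm1.
exact: zonotope_faceP.
Qed.

(** Only the flow component [y] of the supporting functional acts on the cell, and its sign vector
    is the required [D]. *)
Lemma face_is_zonotope_face (F : (E -> R) -> Prop) : is_face (@voronoiO V E src tgt R) F ->
  exists D, flow_orientation D /\ forall x, F x <-> zonotope_face D x.
Proof.
move=> [[x0 Fx0] [a [b [ab FE]]]].
have [y [f [yf aE]]] := flow_decomposition a.
have ax x : voronoiO src tgt x -> dotc a x = dotc y x.
  by case=> xf _; rewrite dotcC (dotc_lift xf aE) dotcC.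
pose D : porient E := [ffun e => osg (y e)].
have yD e : osg (y e) = D e by rewrite ffunE.
exists D; split; first by exists y.
have [x1 [_ [/(zonotope_faceP _ yf yD) [x1V x1b] _]]] := zonotope_face_center D.
(* The bound holds at the centre [x1], and nonemptiness of [F] makes it attained at [x0]; so [b] is
   the maximum. *)
have bE : b = half_norm1 y.
  apply: le_anti; rewrite -{2}x1b -ax // ab // andbT.
  by have [x0V <-] := (FE x0).1 Fx0; rewrite ax // voronoiO_half_norm1.
move=> x; rewrite FE (zonotope_faceP _ yf yD) bE.
by split=> [[xV]|[xV]]; rewrite ?ax // -ax.
Qed.

(** * Lattice translations and reversal of arcs *)

Definition translate_orientation D (z : E -> int) : porient E :=
  [ffun e => if z e == 0 then D e else omap negb (D e)].

Lemma sg_translate D (z : E -> int) e :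
  (z e != 0 -> (z e)%:~R = - sg (D e)) ->
  sg (translate_orientation D z e) = sg (D e) + 2 * (z e)%:~R.
Proof.
rewrite ffunE; case: eqP => [->|_ /(_ isT) ->]; first by rewrite mulr0 addr0.
by case: (D e) => [[]|] /=; ring.
Qed.

(* Adding a large multiple of the integer flow [z] reverses the positive flow
   of [D] exactly on the support of [z]. *)
Lemma translate_flow_orientation D (z : E -> int) :
  is_flow src tgt (fun e => (z e)%:~R : R) ->
  (forall e, z e != 0 -> (z e)%:~R = - sg (D e)) ->
  flow_orientation D -> flow_orientation (translate_orientation D z).
Proof.
move=> zf zD [y [yf yD]].
pose N := 1 + \sum_e `|y e|.
have yN e : `|y e| < N.
  rewrite /N (bigD1 e) //=; have : 0 <= \sum_(i | i != e) `|y i| by apply: sumr_ge0.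
  by lra.
exists (fun e => y e + N * (z e)%:~R); split=> [|e]; first exact: is_flow_linear.
rewrite ffunE; case: eqP => [->|/eqP z0]; first by rewrite mulr0 addr0.
rewrite zD // -yD; have := yN e; have /eqP := zD e z0; rewrite -yD.
have := sg_osg (y e); case: (osg (y e)) => [[]|] /=; last first.
- by rewrite oppr0 intr_eq0 (negbTE z0).
- rewrite mulN1r => <- _ yn; rewrite -(osgK (Some true) (r := y e + N * 1)) /=.
    by rewrite mul1r opprK.
  by lra.
rewrite mul1r => <- _ yn; rewrite -(osgK (Some false) (r := N - y e)) /=.
  by congr osg; ring.
by lra.
Qed.

Lemma half_integral_term_ge0 d (z : int) : 0 <= sg d * z%:~R + z%:~R ^+ 2 :> R.
Proof.
have := norm_le_sqr_int z; have := ler_norm (z%:~R : R); have := ler_norm (- z%:~R : R).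
by rewrite normrN; case: d => [[]|] /=; lra.
Qed.

Lemma face_translation_support D1 D2 l :
  in_Lambda src tgt l -> flow_orientation D2 ->
  (forall x, zonotope_face D1 x -> zonotope_face D2 (fun e => x e + l e)) ->
  (forall e, l e != 0 -> l e = - sg (D1 e)) /\
  (forall e, D2 e != None -> sg (D1 e) + 2 * l e = sg (D2 e)).
Proof.
move=> lL [y [yf yD]] incl.
have [x [f [xD1 xE]]] := zonotope_face_center D1.
have xD2 := incl _ xD1; have [[z lz] lf] := lL.
have [_ xV] := zonotope_face_voronoiO xD1.
have [_ xlV] := zonotope_face_voronoiO xD2.
have supp e : l e != 0 -> l e = - sg (D1 e).
  (* Both [x] and [x + l] lie in the cell, so the Voronoi inequalities at [- l] and [l] give them
     equal norm. *)
  have := xV _ (in_LambdaN lL); have := xlV _ lL.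
  have -> : (fun e => x e + l e - l e) = x.
    by apply: functional_extensionality => e'; rewrite addrK.
  have -> : (fun e => x e - - l e) = (fun e => x e + l e).
    by apply: functional_extensionality => e'; rewrite opprK.
  move=> le1 le2; have := le_anti (introT andP (conj le1 le2)).
  rewrite qcD dotcC -(dotc_lift lf xE) => eq0.
  have : \sum_e (sg (D1 e) * (z e)%:~R + (z e)%:~R ^+ 2) = 0 :> R.
    have : 2 * dotc l (fun e => sg (D1 e) / 2) + qc l = 0 by lra.
    rewrite /qc /dotc mulr_sumr -big_split /= => h; apply: etrans h.
    by apply: eq_bigr => e' _; rewrite lz; field.
  move=> /eqP; rewrite psumr_eq0 => [|e' _]; last exact: half_integral_term_ge0.
  move=> /allP/(_ e (mem_index_enum _)); rewrite /= -lz expr2 -mulrDl mulf_eq0.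
  by case/orP => [|->//]; rewrite addrC addr_eq0 => /eqP.
split=> // e De2.
(* Half the reversed orientation projects to [x + l], a point of the face of [D2]. It therefore
   attains the maximum of [y] on the cube and must equal [D2 / 2] on the support of [D2]. *)
have box : half_box (fun e => sg (translate_orientation D1 z e) / 2).
  exact: half_box_sg.
have trE e' : sg (translate_orientation D1 z e') = sg (D1 e') + 2 * l e'.
  rewrite lz sg_translate -?lz // => z0; apply: supp.
  by rewrite lz intr_eq0.
have : dotc y (fun e => sg (translate_orientation D1 z e) / 2) = half_norm1 y.
  have [_ <-] := (zonotope_faceP _ yf yD).1 xD2.
  apply: (dotc_lift (f := f)) => // e'.
  by rewrite trE mulrDl xE; field.
move/half_norm1_attained => /(_ box e); rewrite yD trE => /(_ De2); lra.
Qed.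

(** Out-degree minus in-degree is twice the out-degree minus the total degree, which depends only on
    the subgraph and counts a loop twice. *)
Lemma boundary_sgE D v : boundary (fun e => sg (D e)) v =
  2 * (outdeg src tgt D v)%:R
  - \sum_e (D e != None)%:R * ((src e == v)%:R + (tgt e == v)%:R).
Proof.
rewrite boundaryE /outdeg -sum1_card natr_sum [X in 2 * X]big_mkcond mulr_sumr -sumrB.
apply: eq_bigr => e _; rewrite inE.
by case: (D e) => [[]|] /=; case: eqP => _; case: eqP => _ /=; ring.
Qed.

Lemma sg_flow_diff D1 D2 l : (forall e, sg (D1 e) + 2 * l e = sg (D2 e)) ->
  (forall e, (D1 e == None) = (D2 e == None)) ->
  is_flow src tgt l <-> forall v, outdeg src tgt D1 v = outdeg src tgt D2 v.
Proof.
move=> lE suppE.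
have bE v : boundary l v =
    (outdeg src tgt D2 v)%:R - (outdeg src tgt D1 v)%:R.
  have : boundary (fun e => sg (D1 e) + 2 * l e) v = boundary (fun e => sg (D2 e)) v.
    by rewrite (functional_extensionality _ (fun e => sg (D2 e)) lE).
  rewrite boundary_linear !boundary_sgE.
  under eq_bigr => e _ do rewrite suppE.
  lra.
split=> [lf v|h v]; last by rewrite -/(boundary l v) bE h subrr.
have := bE v; rewrite /boundary lf => /esym/eqP.
by rewrite subr_eq0 eqr_nat => /eqP.
Qed.

Lemma zonotope_face_translate D1 D2 l x : is_flow src tgt l ->
  (forall e, sg (D1 e) + 2 * l e = sg (D2 e)) ->
  (forall e, (D1 e == None) = (D2 e == None)) ->
  zonotope_face D1 x -> zonotope_face D2 (fun e => x e + l e).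
Proof.
move=> lf lE suppE [xf [eps [f [box [epsD epsE]]]]]; split; first exact: is_flowD.
have epsD2 e : D2 e != None -> eps e + l e = sg (D2 e) / 2.
  by rewrite -suppE => /epsD ->; rewrite -lE; field.
exists (fun e => eps e + l e), f; split=> [e|].
  (* Off the common support [l] vanishes, so the shifted lift stays in the cube there. *)
  have [De|/epsD2 ->] := eqVneq (D2 e) None; last exact: half_box_sg.
  have := lE e; rewrite De; have := suppE e; rewrite De eqxx => /eqP -> /= h.
  have -> : l e = 0 by lra.
  by rewrite addr0.
by split=> // e; rewrite epsE; ring.
Qed.

End Flows.

(** * The correspondence between face classes and orientation classes *)

Section FaceOrientation.
Variables (R : realFieldType) (V E : finType) (src tgt : E -> V).
Local Notation FPt := (FP src tgt R).
Local Notation SCt := (SC src tgt).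

Lemma orientation_of_face_ex (F : FPt) : exists D : SCt,
  forall x, sval F x <-> zonotope_face src tgt (sval D) x.
Proof.
have [D [Df FD]] := face_is_zonotope_face (svalP F).
by exists (exist _ D (flow_strongly_connected Df)).
Qed.

Definition orientation_of_face (F : FPt) : SCt :=
  proj1_sig (constructive_indefinite_description _ (orientation_of_face_ex F)).

Lemma orientation_of_faceP F x :
  sval F x <-> zonotope_face src tgt (sval (orientation_of_face F)) x.
Proof.
by rewrite /orientation_of_face; case: constructive_indefinite_description => D /= ->.
Qed.

Lemma SC_flow (D : SCt) : flow_orientation R src tgt (sval D).
Proof. exact: strongly_connected_flow (svalP D). Qed.

Definition face_of_orientation (D : SCt) : FPt :=
  exist _ (zonotope_face src tgt (sval D)) (zonotope_face_is_face (SC_flow D)).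

(** Turns an inclusion of translated faces into the order on orientations; the witness reverses [D1]
    on the support of [l]. *)
Lemma face_translation_orientation (D1 D2 : SCt) (l : E -> R) : in_Lambda src tgt l ->
  (forall x, zonotope_face src tgt (sval D1) x ->
     zonotope_face src tgt (sval D2) (fun e => x e + l e)) ->
  exists D : SCt, sc_eq D1 D /\ sc_pre D D2.
Proof.
move=> lL incl.
have [supp eqD2] := face_translation_support lL (SC_flow D2) incl.
have [[z lz] lf] := lL.
have zD e : z e != 0 -> (z e)%:~R = - sg R (sval D1 e).
  by move=> z0; rewrite -lz supp // lz intr_eq0.
have Df : flow_orientation R src tgt (translate_orientation (sval D1) z).
  apply: translate_flow_orientation => //; last exact: SC_flow.
  by have := lf; rewrite (functional_extensionality _ _ lz).
pose D : SCt := exist _ _ (flow_strongly_connected Df).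
have DE e : sg R (sval D1 e) + 2 * l e = sg R (sval D e).
  by rewrite lz /= sg_translate //; exact: zD.
have DN e : (sval D1 e == None) = (sval D e == None).
  by rewrite /= ffunE; case: ifP => _ //; case: (sval D1 e).
exists D; split; first by split=> //; exact/(sg_flow_diff src tgt DE DN).
by move=> e /eqD2; rewrite DE => /sg_inj.
Qed.

Lemma sc_eq_translation (D1 D2 : SCt) : sc_eq D1 D2 ->
  exists l : E -> R, in_Lambda src tgt l /\
    forall x, zonotope_face src tgt (sval D1) x <->
      zonotope_face src tgt (sval D2) (fun e => x e + l e).
Proof.
case=> DN deg.
(* This is [(D2 - D1) / 2], integral because the supports coincide. *)
pose z e : int := if sval D1 e == sval D2 e then 0
  else if sval D2 e == Some true then 1 else -1.
have lE e : sg R (sval D1 e) + 2 * (z e)%:~R = sg R (sval D2 e).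
  have := DN e; rewrite /z.
  by case: (sval D1 e) => [[]|]; case: (sval D2 e) => [[]|] //= _; ring.
have zf := (sg_flow_diff src tgt lE DN).2 deg.
exists (fun e => (z e)%:~R); split; first by split=> //; exists z.
move=> x; split; first exact: zonotope_face_translate.
have -> : x = (fun e => (x e + (z e)%:~R) + - (z e)%:~R).
  by apply: functional_extensionality => e; rewrite addrK.
move=> h; apply: (zonotope_face_translate (D1 := sval D2) (is_flowN zf)) => [e|e|].
- by rewrite -lE; ring.
- by rewrite DN.
by move: h; congr zonotope_face; apply: functional_extensionality => e; rewrite subrK.
Qed.

Lemma translation_sc_eq (D1 D2 : SCt) (l : E -> R) : in_Lambda src tgt l ->
  (forall x, zonotope_face src tgt (sval D1) x <->
     zonotope_face src tgt (sval D2) (fun e => x e + l e)) -> sc_eq D1 D2.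
Proof.
move=> lL h.
have [D [[DN deg] pre]] := face_translation_orientation lL (fun x => (h x).1).
have h' x : zonotope_face src tgt (sval D2) x ->
    zonotope_face src tgt (sval D1) (fun e => x e + - l e).
  move=> xD2; apply/h; move: xD2; congr zonotope_face.
  by apply: functional_extensionality => e; rewrite subrK.
have [D' [[DN' _] pre']] := face_translation_orientation (in_LambdaN lL) h'.
(* The reverse inclusion bounds the support of [D1], hence that of [D], by the support of [D2]; so
   the extension [D] of [D2] is [D2] itself. *)
have pre_None (A B : SCt) e : sc_pre A B -> sval A e == None -> sval B e == None.
  by move=> p /eqP Ae; apply/idPn => /[dup] /p; rewrite Ae => <-.
have DD2 : sval D = sval D2.
  apply/ffunP => e; have [D2e|/pre//] := eqVneq (sval D2 e) None.
  by apply/eqP; rewrite D2e -DN (pre_None _ _ _ pre') // -DN' D2e.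
by split; rewrite -DD2.
Qed.

Lemma fp_eqE (F1 F2 : FPt) :
  fp_eq F1 F2 <-> sc_eq (orientation_of_face F1) (orientation_of_face F2).
Proof.
split=> [[l [lL h]]|/sc_eq_translation [l [lL h]]].
  apply: translation_sc_eq lL _ => x; rewrite -!orientation_of_faceP h.
  by rewrite (_ : (fun e => _) = x) //; apply: functional_extensionality => e; rewrite addrK.
exists l; split=> // x; rewrite !orientation_of_faceP h.
by rewrite (_ : (fun e => _) = x) //; apply: functional_extensionality => e; rewrite subrK.
Qed.

Lemma fp_leE (F1 F2 : FPt) :
  fp_le F1 F2 <-> sc_le (orientation_of_face F1) (orientation_of_face F2).
Proof.
split=> [[l [lL h]]|[D1 [D2 [e1 [e2 pre]]]]].
  have [|D [De pre]] := @face_translation_orientation (orientation_of_face F1)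
    (orientation_of_face F2) l lL.
    by move=> x; rewrite -!orientation_of_faceP; exact: h.
  by exists D, (orientation_of_face F2); do !split; case: De.
(* Translations by [l1] and [l2] move to the comparable representatives. There [D1] fixes at least
   the coordinates that [D2] fixes, so its face is literally contained in the other. *)
have [l1 [l1L h1]] := sc_eq_translation e1.
have [l2 [l2L h2]] := sc_eq_translation e2.
exists (fun e => l1 e + - l2 e); split.
  have [[z1 z1E] f1] := l1L; have [[z2 z2E] f2] := l2L.
  split; last exact: is_flowB.
  by exists (fun e => z1 e - z2 e) => e; rewrite rmorphB z1E z2E.
move=> x; rewrite !orientation_of_faceP h1 h2.
case=> xf [eps [f [box [epsD epsE]]]].
rewrite (_ : (fun e => _) = (fun e => x e + l1 e)); last first.
  by apply: functional_extensionality => e; rewrite addrA subrK.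
split=> //; exists eps, f; split=> //; split=> // e D2e.
by rewrite -pre // epsD // pre.
Qed.

End FaceOrientation.

Theorem mainTheorem11 (R : realFieldType) (V E : finType) (src tgt : E -> V)
  (Gconn : connected_graph src tgt) :
  quotient_poset_iso
    (@fp_eq V E src tgt R) (@fp_le V E src tgt R)
    (@sc_eq V E src tgt) (@sc_le V E src tgt).
Proof.
have sc_refl (D : SC src tgt) : sc_eq D D by [].
have fg (D : SC src tgt) :
    sc_eq (orientation_of_face (face_of_orientation R D)) D.
  apply: (@translation_sc_eq R _ _ _ _ _ _ (fun=> 0)); first exact: in_Lambda0.
  move=> x; rewrite -orientation_of_faceP /=.
  by rewrite (_ : (fun e => _) = x) //; apply: functional_extensionality => e; rewrite addr0.
have sc_trans (D1 D2 D3 : SC src tgt) : sc_eq D1 D2 -> sc_eq D2 D3 -> sc_eq D1 D3.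
  by move=> [N12 d12] [N23 d23]; split=> ?; rewrite ?N12 ?d12.
have sc_sym (D1 D2 : SC src tgt) : sc_eq D1 D2 -> sc_eq D2 D1.
  by move=> [N12 d12]; split=> ?; rewrite ?N12 ?d12.
exists (@orientation_of_face R V E src tgt), (@face_of_orientation R V E src tgt).
split; first by move=> F1 F2 h; apply/fp_eqE.
split.
  move=> D1 D2 h; apply/fp_eqE.
  exact: sc_trans (fg _) (sc_trans _ _ _ h (sc_sym _ _ (fg _))).
split; first by move=> F; apply/fp_eqE; exact: fg.
by split; [exact: fg|exact: fp_leE].
Qed.
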